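(* Let $\mathbf A,\mathbf B\in\mathbb R^{n\times n}$ be s.p.d. matrices with $\operatorname{rank}(\mathbf A)\ge\operatorname{rank}(\mathbf B)$. In block form with respect to $\mathcal H_1\oplus\mathcal H_2$, $\mathcal H_1=\mathcal R(\mathbf A)$, $\mathcal H_2=\mathcal N(\mathbf A)$, let $\mathbf G=\begin{pmatrix}\mathbf G_{11}&\mathbf 0\\\mathbf 0&\mathbf 0\end{pmatrix}$ with $\mathbf G_{11}\in\mathcal G(\mathbf A_{11})$. Then the set of all matrices $\mathbf M\in\mathcal G(\mathbf B)$ satisfying $\mathbf G^*\mathbf M\succeq\mathbf 0$ is the set of all $$\mathbf M=\begin{pmatrix}(\mathbf G_{11}^* )^{-1}(\mathbf G_{11}^*\mathbf B_{11}\mathbf G_{11})^{1/2}&\mathbf 0\\\mathbf B_{21}\mathbf G_{11}(\mathbf G_{11}^*\mathbf B_{11}\mathbf G_{11})^{\dagger/2}+\mathbf N_{12}^*&\mathbf M_{22}\end{pmatrix}:\mathcal H_1\oplus\mathcal H_2\to\mathcal H_1\oplus\mathcal H_2,$$ where - $\mathbf N_{12}:\mathcal H_2\to\mathcal H_1$ satisfies $\mathcal R(\mathbf N_{12})\subset\mathcal N(\mathbf B_{11}^{1/2}\mathbf G_{11})$ and $\mathbf N_{12}^*\mathbf N_{12}\preceq\mathbf B/\mathbf A$; - $\mathbf M_{22}:\mathcal H_2\to\mathcal H_2$ satisfies $\mathbf M_{22}\mathbf M_{22}^*=\mathbf B/\mathbf A-\mathbf N_{12}^*\mathbf N_{12}$.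 A solution corresponds to a Monge map (i.e. $\mathbf M=\mathbf T\mathbf G$ for some OT matrix $\mathbf T$ from $\mathbf A$ to $\mathbf B$) if and only if $\mathbf M_{22}=\mathbf 0$ (i.e. $\mathbf N_{12}^*\mathbf N_{12}=\mathbf B/\mathbf A$).
   Context: s.p.d. (or $\succeq\mathbf 0$) means symmetric positive semidefinite. $^*$ is the transpose, $^\dagger$ the Moore–Penrose pseudoinverse, $\mathbf C^{\dagger/2}:=(\mathbf C^{1/2})^\dagger$; $\mathcal R,\mathcal N$ are range and null space. $\mathcal G(\mathbf A)$ is the set of Green's matrices of $\mathbf A$: square matrices $\mathbf G$ with $\mathbf G\mathbf G^*=\mathbf A$. Blocks: $\mathbf A_{11}=\mathbf A|_{\mathcal H_1}$ (invertible on $\mathcal H_1$), $\mathbf B_{ij}:\mathcal H_j\to\mathcal H_i$. Schur complement: $\mathbf B/\mathbf A:=\mathbf B_{22}-\mathbf B_{21}\mathbf B_{11}^\dagger\mathbf B_{12}:\mathcal H_2\to\mathcal H_2$. An OT matrix from $\mathbf A$ to $\mathbf B$ is $\mathbf T\in\mathbb R^{n\times n}$ with $\mathbf T\mathbf A\mathbf T^*=\mathbf B$ and $\operatorname{tr}(\mathbf A\mathbf T)=\operatorname{tr}[(\mathbf A^{1/2}\mathbf B\mathbf A^{1/2})^{1/2}]$. *)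

(* Defs.v *)
From mathcomp Require Import all_boot all_order all_algebra.
From mathcomp Require Import boolp classical_sets reals.

Set Implicit Arguments.
Unset Strict Implicit.
Unset Printing Implicit Defensive.

Import Order.TTheory GRing.Theory Num.Theory.
Local Open Scope classical_set_scope.
Local Open Scope ring_scope.

Section Definitions.
Variable R : realType.

Definition psd n (S : 'M[R]_n) : Prop :=
  S^T = S /\ forall v : 'cV[R]_n, 0 <= (v^T *m S *m v) 0 0.

Definition psd_le n (S T : 'M[R]_n) : Prop := psd (T - S).

(* The square root is the unique positive semidefinite matrix with square S; *)
(* it exists if and only if S is positive semidefinite, and the default      *)
(* value 0 is returned otherwise.                                            *)
Definition psd_sqrt n (S : 'M[R]_n) : 'M[R]_n :=
  xget 0 [set X | psd X /\ X *m X = S].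

(* The four Penrose equations have exactly one solution for every real X, so *)
(* the default value is never reached. MathComp's pinvmx is only a           *)
(* generalized inverse: it need not satisfy the two symmetry equations.      *)
Definition mp_inv m n (X : 'M[R]_(m, n)) : 'M[R]_(n, m) :=
  xget 0 [set Y | [/\ X *m Y *m X = X, Y *m X *m Y = Y,
                      (X *m Y)^T = X *m Y & (Y *m X)^T = Y *m X]].

(* Matrices act on column vectors, whereas the subspaces of mxalgebra are    *)
(* row spaces.                                                               *)
Definition mxrange m n (X : 'M[R]_(m, n)) : set 'cV[R]_m :=
  [set v | exists u : 'cV[R]_n, v = X *m u].

Definition mxnull m n (X : 'M[R]_(m, n)) : set 'cV[R]_n :=
  [set v | X *m v = 0].

Definition greens n (S : 'M[R]_n) : set 'M[R]_n :=
  [set G | G *m G^T = S].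

(* The columns of U form an orthonormal basis of the subspace E. Operators   *)
(* between subspaces are written as matrices in such bases, so that adjoints *)
(* are transposes.                                                           *)
Definition onbasis n r (U : 'M[R]_(n, r)) (E : set 'cV[R]_n) : Prop :=
  U^T *m U = 1%:M /\ mxrange U = E.

(* The block of X from the span of V to the span of U.                       *)
Definition blk n r m (U : 'M[R]_(n, r)) (V : 'M[R]_(n, m)) (X : 'M[R]_n) :
    'M[R]_(r, m) :=
  U^T *m X *m V.

(* The operator on R^n with the given blocks, U and V being orthonormal      *)
(* bases of two orthogonal complements.                                      *)
Definition of_blocks n r m (U : 'M[R]_(n, r)) (V : 'M[R]_(n, m))
    (X11 : 'M[R]_r) (X12 : 'M[R]_(r, m)) (X21 : 'M[R]_(m, r)) (X22 : 'M[R]_m) :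
    'M[R]_n :=
  row_mx U V *m block_mx X11 X12 X21 X22 *m (row_mx U V)^T.

(* The generalized Schur complement B / A, where U and V are orthonormal     *)
(* bases of the range and of the null space of A.                            *)
Definition schur_compl n r m (U : 'M[R]_(n, r)) (V : 'M[R]_(n, m))
    (B : 'M[R]_n) : 'M[R]_m :=
  blk V V B - blk V U B *m mp_inv (blk U U B) *m blk U V B.

Definition ot_matrix n (A B T : 'M[R]_n) : Prop :=
  T *m A *m T^T = B /\
  \tr (A *m T) = \tr (psd_sqrt (psd_sqrt A *m B *m psd_sqrt A)).

End Definitions.

(* Main.v *)
(* Write M in blocks for the splitting of R^n into range and null space of A. *)
(* Positivity of G^T M makes its first block row (S, 0) with S psd, and then  *)
(* M M^T = B forces S^2 = C := G11^T B11 G11 and M21 S = B21 G11, so M21 is   *)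
(* determined up to a term N12^T vanishing on the range of S. If B = L L^T    *)
(* and L1 is the first block row of L, then L1^T G11 C^+ G11^T L1 and         *)
(* L1^T B11^+ L1 are both the orthogonal projection onto the row space of L1; *)
(* this turns the remaining equation into M22 M22^T = B/A - N12^T N12. Since  *)
(* G vanishes on the null space of A, M = T G forces M22 = 0. Conversely, if  *)
(* M22 = 0 then M = W U^T, and T = W G11^-1 U^T works, its trace being        *)
(* tr S = tr (X X^T)^(1/2) = tr (X^T X)^(1/2) with X = G11^T U^T L.           *)

Require Import Defs.
From mathcomp Require Import all_boot all_order all_algebra.
From mathcomp Require Import boolp classical_sets reals complex.

Set Implicit Arguments.
Unset Strict Implicit.
Unset Printing Implicit Defensive.

Import Order.TTheory GRing.Theory Num.Theory.
Local Open Scope classical_set_scope.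
Local Open Scope ring_scope.

(** The solution set reduces to the block equations M11 M11^T = B11, M21 M11^T = B21 and M21 M21^T +
    M22 M22^T = B22. Positivity makes G11^T M11 a psd matrix with square C, so [psd_sqrt_unique]
    leaves no freedom in M11; the second equation is linear in M21, with the freedom N12^T
    ([factor_block21_solution]); the third becomes the condition on M22 once M21 M21^T is computed
    by [factor_block22], which rests on [gram_projection]. As [psd_sqrt] and [mp_inv] are choices by
    [xget], existence and uniqueness come first. Existence follows from the spectral theorem: both
    objects are polynomials in a symmetric S that interpolate the wanted function on its spectrum.
    The Monge criterion uses A = F F^T with F = U G11, and the invariance of the trace under the
    choice of F ([tr_psd_sqrt_gram_conj]). *)

Lemma poly_interpolation (F : fieldType) (f : F -> F) (s : seq F) :
  exists p : {poly F}, {in s, forall a, p.[a] = f a}.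
Proof.
elim: s => [|a s [p hp]]; first by exists 0.
have [sa|nsa] := boolP (a \in s).
  by exists p => b; rewrite inE => /orP[/eqP->|]; apply: hp.
pose w := \prod_(b <- s) ('X - b%:P).
have wa : w.[a] != 0.
  by rewrite -rootE root_prod_XsubC.
exists (p + ((f a - p.[a]) / w.[a]) *: w) => b.
rewrite inE !hornerE => /orP[/eqP->|bs]; first by rewrite divfK // addrC subrK.
have /eqP -> : w.[b] == 0 by rewrite -rootE root_prod_XsubC.
by rewrite mulr0 addr0 hp.
Qed.

(** * Gram matrices *)

Section RealMatrices.
Variable R : realType.

Lemma mulmx_tr_eq0 m n (Z : 'M[R]_(m, n)) : Z *m Z^T = 0 -> Z = 0.
Proof.
move=> /matrixP h; apply/matrixP => i j; have := h i i; rewrite !mxE => /eqP.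
rewrite psumr_eq0 => [/allP/(_ j (mem_index_enum _))|k _]; last first.
  by rewrite mxE -expr2 sqr_ge0.
by rewrite mxE mulf_eq0 orbb => /eqP.
Qed.

Lemma tr_mulmx_eq0 m n (Z : 'M[R]_(m, n)) : Z^T *m Z = 0 -> Z = 0.
Proof.
by move=> h; apply: trmx_inj; rewrite trmx0; apply: mulmx_tr_eq0; rewrite trmxK.
Qed.

Lemma mulmx_gram_eq0 l m n (W : 'M[R]_(l, m)) (K : 'M[R]_(m, n)) :
  W *m (K *m K^T) = 0 -> W *m K = 0.
Proof.
by move=> h; apply: mulmx_tr_eq0; rewrite trmx_mul mulmxA -(mulmxA W) h mul0mx.
Qed.

Lemma psd_gram m n (K : 'M[R]_(m, n)) : psd (K *m K^T).
Proof.
split=> [|v]; first by rewrite trmx_mul trmxK.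
rewrite mulmxA -[v^T *m K]trmxK trmx_mul trmxK -mulmxA mxE.
by apply: sumr_ge0 => i _; rewrite mxE -expr2 sqr_ge0.
Qed.

(** * Spectral calculus and psd square roots *)

(** Over [complex R], S is Hermitian, hence unitarily diagonalizable with real spectrum, and p(S) is
    conjugate to the diagonal of the values of p. Identities between polynomials in S can thus be
    checked on eigenvalues. *)
Lemma sym_annihilating_eigenvalues n (S : 'M[R]_n.+1) : S^T = S ->
  exists2 s : seq R, {in s, forall a, eigenvalue S a} &
    forall p, {in s, forall a, p.[a] = 0} -> horner_mx S p = 0.
Proof.
move=> Ssym; pose f : {rmorphism R -> complex R} := real_complex R.
pose Sc := map_mx f S.
have herm : Sc \is hermsymmx.
  apply: realsym_hermsym.
    by apply/is_hermitianmxP; rewrite expr0 scale1r map_mx_id // map_trmx Ssym.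
  by apply/mxOverP => i j; rewrite mxE; apply/complex_realP; exists (S i j).
have Dreal := hermitian_spectral_diag_real herm.
have /orthomx_spectralP Seq := hermitian_normalmx herm.
have Pu := spectral_unit Sc.
set P := spectralmx Sc in Pu Seq; set D := spectral_diag Sc in Seq Dreal.
have DE j : D 0 j = f (complex.Re (D 0 j)).
  exact/esym/RRe_real/(mxOverP Dreal).
exists [seq complex.Re (D 0 i) | i <- enum 'I_n.+1].
  move=> _ /mapP[i _ ->]; rewrite -(eigenvalue_map f) -DE.
  apply/eigenvalueP; exists (row i P).
    rewrite -/Sc Seq !mulmxA -row_mul mulmxV // row1 -rowE row_diag_mx.
    by rewrite -scalemxAl -rowE.
  apply/eqP => P0; have : row i P *m invmx P = 0 by rewrite P0 mul0mx.
  rewrite -row_mul mulmxV // row1 => /rowP/(_ i); rewrite !mxE !eqxx => /eqP.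
  by rewrite oner_eq0.
move=> p hp; apply: (map_mx_inj (f := f)).
rewrite map_horner_mx -/Sc Seq horner_mx_uconjC // horner_mx_diag map_mx0.
suff -> : map_mx (horner (map_poly f p)) D = 0 by rewrite raddf0 mulmx0 mul0mx.
apply/rowP => j; rewrite !mxE DE horner_map hp ?rmorph0 //.
by apply/mapP; exists j => //; rewrite mem_enum.
Qed.

Lemma trmx_horner_mx n (S : 'M[R]_n.+1) p :
  S^T = S -> (horner_mx S p)^T = horner_mx S p.
Proof.
move=> Ssym; elim/poly_ind: p => [|p c ihp]; first by rewrite rmorph0 trmx0.
rewrite rmorphD rmorphM /= horner_mx_X horner_mx_C linearD /= trmx_mul.
by rewrite tr_scalar_mx ihp Ssym; congr (_ + _); apply: comm_mx_horner.
Qed.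

Lemma psd_eigenvalue_ge0 n (S : 'M[R]_n) a :
  psd S -> eigenvalue S a -> 0 <= a.
Proof.
case=> _ h /eigenvalueP[v vS v0]; have := h v^T.
rewrite trmxK vS -scalemxAl mxE pmulr_lge0 // lt_neqAle.
have v2 : 0 <= (v *m v^T) 0 0.
  by rewrite mxE sumr_ge0 // => i _; rewrite mxE -expr2 sqr_ge0.
rewrite v2 andbT eq_sym; apply: contra v0 => /eqP v00.
by apply/eqP/mulmx_tr_eq0/matrixP => i j; rewrite !ord1 v00 mxE.
Qed.

(* Q = q(S)^2 with q interpolating the fourth root on the spectrum of S: the  *)
(* square makes Q psd, and a polynomial in S commutes with the commutant.     *)
Lemma exists_psd_sqrt n (S : 'M[R]_n) : psd S ->
  exists Q : 'M[R]_n, [/\ psd Q, Q *m Q = S &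
    forall X : 'M[R]_n, X *m S = S *m X -> X *m Q = Q *m X].
Proof.
(* [horner_mx] requires a nonzero dimension, so size 0 is separate. *)
case: n S => [|n] S psdS.
  exists 0; split=> [||X _]; last by rewrite mulmx0 mul0mx.
    by rewrite -[0](mulmx0 _ (0 : 'M_0)) -[X in _ *m X](trmx0 _ 0 0);
      apply: psd_gram.
  by rewrite mulmx0 [S]flatmx0.
have [Ssym _] := psdS.
have [s hs sE] := sym_annihilating_eigenvalues Ssym.
have [q hq] := poly_interpolation (fun a => Num.sqrt (Num.sqrt a)) s.
have qsym := trmx_horner_mx q Ssym.
exists (horner_mx S q *m horner_mx S q); split.
- by rewrite -[X in _ *m X]qsym; apply: psd_gram.
- apply/eqP; rewrite -subr_eq0; apply/eqP.
  set Q := horner_mx S q.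
  have -> : Q *m Q *m (Q *m Q) - S = horner_mx S (q * q * (q * q) - 'X).
    by rewrite rmorphB !rmorphM /= horner_mx_X.
  apply: sE => a sa; rewrite hornerD hornerN hornerX !hornerM hq //.
  have a0 := psd_eigenvalue_ge0 psdS (hs _ sa).
  by rewrite -!expr2 !sqr_sqrtr ?sqrtr_ge0 ?subrr.
- move=> X XS; have h : X *m horner_mx S q = horner_mx S q *m X.
    exact: comm_mx_horner.
  by rewrite mulmxA h -!mulmxA h.
Qed.

Lemma psd_sqrtP n (S : 'M[R]_n) :
  psd S -> psd (psd_sqrt S) /\ psd_sqrt S *m psd_sqrt S = S.
Proof.
move=> /exists_psd_sqrt[Q [psdQ QQ _]].
exact: (@xgetI _ 0 [set X | psd X /\ X *m X = S] Q).
Qed.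

(** With H and K the roots of X and Y, the sum is Z Z^T for Z = (D H, D K), so its vanishing kills D
    H. *)
Lemma psd_conj_eq0 n (D X Y : 'M[R]_n) : D^T = D -> psd X -> psd Y ->
  D *m X *m D + D *m Y *m D = 0 -> D *m X *m D = 0.
Proof.
move=> Dsym /psd_sqrtP[[Hs _] HH] /psd_sqrtP[[Ks _] KK].
set H := psd_sqrt X in Hs HH; set K := psd_sqrt Y in Ks KK.
have gram Z Z' :
    Z^T = Z -> Z *m Z = Z' -> D *m Z' *m D = (D *m Z) *m (D *m Z)^T.
  by move=> Zs <-; rewrite trmx_mul Dsym Zs !mulmxA.
rewrite (gram _ _ Hs HH) (gram _ _ Ks KK) => h.
suff -> : D *m H = 0 by rewrite mul0mx.
have := @mulmx_tr_eq0 _ _ (row_mx (D *m H) (D *m K)).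
rewrite tr_row_mx mul_row_col => /(_ h) /eqP.
by rewrite row_mx_eq0 => /andP[/eqP].
Qed.

(* With D := X - Y, the sum D X D + D Y D = D (X^2 - Y^2) vanishes, so both   *)
(* psd summands do, and D^3 = D X D - D Y D = 0.                              *)
Lemma comm_psd_sqrt_unique n (X Y : 'M[R]_n) : psd X -> psd Y ->
  X *m Y = Y *m X -> X *m X = Y *m Y -> X = Y.
Proof.
move=> psdX psdY XY XX; apply/eqP; rewrite -subr_eq0; apply/eqP.
set D := X - Y; have Dsym : D^T = D by rewrite linearB /= psdX.1 psdY.1.
have hD : X *m D + Y *m D = 0.
  by rewrite !mulmxBr XX XY addrA subrK subrr.
have hX : D *m X *m D = 0.
  apply: (psd_conj_eq0 Dsym psdX psdY).
  by rewrite -!mulmxA -mulmxDr hD mulmx0.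
have hY : D *m Y *m D = 0.
  apply: (psd_conj_eq0 Dsym psdY psdX).
  by rewrite -!mulmxA -mulmxDr addrC hD mulmx0.
have D3 : D *m D *m D = 0.
  by rewrite -[RHS]subr0 -{1}hX -hY -mulmxBl -mulmxBr.
apply: mulmx_tr_eq0; rewrite Dsym; apply: mulmx_tr_eq0.
by rewrite trmx_mul Dsym mulmxA D3 mul0mx.
Qed.

(** Any root of S commutes with S, hence with the root Q of [exists_psd_sqrt]; the commuting case
    applies. *)
Lemma psd_sqrt_unique n (S X : 'M[R]_n) : psd X -> X *m X = S -> psd_sqrt S = X.
Proof.
move=> psdX XX; have psdS : psd S by rewrite -XX -{2}psdX.1; apply: psd_gram.
have [Q [psdQ QQ Qcomm]] := exists_psd_sqrt psdS.
have eqQ Z : psd Z -> Z *m Z = S -> Z = Q.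
  move=> psdZ ZZ; apply: comm_psd_sqrt_unique => //; last by rewrite ZZ QQ.
  by apply: Qcomm; rewrite -ZZ mulmxA.
by have [? ?] := psd_sqrtP psdS; rewrite (eqQ X) //; apply: eqQ.
Qed.

(** * Moore-Penrose inverses *)

Definition penrose m n (X : 'M[R]_(m, n)) (Y : 'M[R]_(n, m)) :=
  [/\ X *m Y *m X = X, Y *m X *m Y = Y,
      (X *m Y)^T = X *m Y & (Y *m X)^T = Y *m X].

Lemma penrose_unique m n (X : 'M[R]_(m, n)) Y Z :
  penrose X Y -> penrose X Z -> Y = Z.
Proof.
move=> [XYX YXY XYs YXs] [XZX ZXZ XZs ZXs].
have e1 : X *m Y = X *m Z.
  by rewrite -XYs -{1}XZX -mulmxA trmx_mul XYs XZs mulmxA XYX.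
have e2 : Y *m X = Z *m X.
  rewrite -YXs -{1}XZX !mulmxA -[Y *m X *m Z *m X]mulmxA trmx_mul YXs ZXs.
  by rewrite -mulmxA (mulmxA X) XYX.
by rewrite -YXY e2 -mulmxA e1 mulmxA.
Qed.

Lemma sym_penrose_exists n (S : 'M[R]_n) : S^T = S -> exists Y, penrose S Y.
Proof.
case: n S => [|n] S Ssym; first by exists 0; split; apply/matrixP => -[].
have [s _ sE] := sym_annihilating_eigenvalues Ssym.
(* The convention that 0 has inverse 0 is what the pseudoinverse does on the kernel. *)
have [q hq] := poly_interpolation GRing.inv s.
have qsym := trmx_horner_mx q Ssym.
have qS : S *m horner_mx S q = horner_mx S q *m S by apply: comm_mx_horner.
exists (horner_mx S q); split; last 2 first.
- by rewrite trmx_mul qsym Ssym.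
- by rewrite trmx_mul qsym Ssym.
- apply/eqP; rewrite -subr_eq0; apply/eqP.
  have -> : S *m horner_mx S q *m S - S = horner_mx S ('X * q * 'X - 'X).
    by rewrite rmorphB !rmorphM /= horner_mx_X.
  apply: sE => a sa; rewrite !(hornerD, hornerN, hornerX, hornerM) hq //.
  have [->|a0] := eqVneq a 0; first by rewrite mulr0 subrr.
  by rewrite divff // mul1r subrr.
- apply/eqP; rewrite -subr_eq0; apply/eqP.
  have -> : horner_mx S q *m S *m horner_mx S q - horner_mx S q
      = horner_mx S (q * 'X * q - q).
    by rewrite rmorphB !rmorphM /= horner_mx_X.
  apply: sE => a sa; rewrite !(hornerD, hornerN, hornerX, hornerM) hq //.
  have [->|a0] := eqVneq a 0; first by rewrite invr0 !mulr0 subrr.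
  by rewrite mulVf // mul1r subrr.
Qed.

Lemma sym_mp_invP n (S : 'M[R]_n) : S^T = S ->
  [/\ S *m mp_inv S *m S = S, mp_inv S *m S *m mp_inv S = mp_inv S,
      S *m mp_inv S = mp_inv S *m S & (mp_inv S)^T = mp_inv S].
Proof.
move=> Ssym; have [Y0 hY0] := sym_penrose_exists Ssym.
have hY : penrose S (mp_inv S) := xgetI 0 hY0.
set Y := mp_inv S in hY *.
have Ysym : Y^T = Y.
  apply: (penrose_unique _ hY); have [XYX YXY XYs YXs] := hY.
  split.
  - by rewrite -Ssym -!trmx_mul mulmxA XYX.
  - by rewrite -Ssym -!trmx_mul mulmxA YXY.
  - by rewrite -Ssym -trmx_mul YXs.
  - by rewrite -Ssym -trmx_mul XYs.
case: hY => XYX YXY XYs _; split=> //.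
by rewrite -XYs trmx_mul Ysym Ssym.
Qed.

(** S S^+ is the orthogonal projection onto the range of S, which is also that of K. *)
Lemma sqrt_mp_fix m n (S : 'M[R]_m) (K : 'M[R]_(m, n)) :
  S^T = S -> S *m S = K *m K^T -> S *m mp_inv S *m K = K.
Proof.
move=> Ssym SS; have [SYS _ _ _] := sym_mp_invP Ssym.
apply/eqP; rewrite -subr_eq0 -{2}[K]mul1mx -mulmxBl; apply/eqP.
by apply: mulmx_gram_eq0; rewrite -SS mulmxA mulmxBl SYS mul1mx subrr mul0mx.
Qed.

Lemma gram_mp_fix m n (K : 'M[R]_(m, n)) :
  K *m K^T *m mp_inv (K *m K^T) *m K = K.
Proof.
have [SYS _ _ _] := sym_mp_invP (psd_gram K).1.
apply/eqP; rewrite -subr_eq0 -{6}[K]mul1mx -mulmxBl; apply/eqP.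
by apply: mulmx_gram_eq0; rewrite mulmxBl SYS mul1mx subrr.
Qed.

(* Both sides are the orthogonal projection onto the row space of K. *)
Lemma gram_projection m n (K : 'M[R]_(m, n)) (G S : 'M[R]_m) :
  G \in unitmx -> S^T = S -> S *m S = G^T *m (K *m K^T) *m G ->
  K^T *m G *m mp_inv S *m mp_inv S *m G^T *m K =
  K^T *m mp_inv (K *m K^T) *m K.
Proof.
move=> Gu Ssym SS; have [SYS _ YS Ysym] := sym_mp_invP Ssym.
have [_ _ _ Zsym] := sym_mp_invP (psd_gram K).1.
have SS' : S *m S = (G^T *m K) *m (G^T *m K)^T.
  by rewrite trmx_mul trmxK SS !mulmxA.
have fixS := sqrt_mp_fix Ssym SS'.
have fixK := gram_mp_fix K.
set Y := mp_inv S in fixS Ysym YS SYS *; set Z := mp_inv _ in Zsym fixK *.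
set P1 := LHS; set P2 := RHS.
have P1s : P1^T = P1 by rewrite /P1 !trmx_mul !trmxK Ysym !mulmxA.
have P2s : P2^T = P2 by rewrite /P2 !trmx_mul !trmxK Zsym !mulmxA.
have KP2 : K *m P2 = K by rewrite /P2 !mulmxA.
have KP1 : K *m P1 = K.
  have GTu : G^T \in unitmx by rewrite unitmx_tr.
  apply: (can_inj (mulKmx GTu)).
  rewrite -[RHS]fixS /P1.
  have -> : G^T *m (K *m (K^T *m G *m Y *m Y *m G^T *m K)) =
      G^T *m (K *m K^T) *m G *m Y *m Y *m (G^T *m K).
    by rewrite !mulmxA.
  by rewrite -SS -(mulmxA S) YS !mulmxA SYS -YS.
have KTP X : X^T = X -> K *m X = K -> X *m K^T = K^T.
  by move=> Xs KX; rewrite -{1}Xs -trmx_mul KX.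
have P21 : P2 *m P1 = P1.
  by rewrite {2}/P1 !mulmxA (KTP P2).
have P12 : P1 *m P2 = P2.
  by rewrite {2}/P2 !mulmxA (KTP P1).
(* P1 and P2 are symmetric and each absorbs the other on its right, so transposing one relation
   gives equality. *)
by rewrite -P12 -P1s -P2s -trmx_mul P21.
Qed.

(** With S the root of X X^T, the root of X^T X is X^T S^+ X, and cyclicity turns its trace into
    that of S^+ S S = S. *)
Lemma tr_psd_sqrt_gram m n (X : 'M[R]_(m, n)) :
  \tr (psd_sqrt (X *m X^T)) = \tr (psd_sqrt (X^T *m X)).
Proof.
have [psdS SS] := psd_sqrtP (psd_gram X).
set S := psd_sqrt _ in psdS SS *.
have [SYS YSY YS Ysym] := sym_mp_invP psdS.1.
have fixX := sqrt_mp_fix psdS.1 SS.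
set Y := mp_inv S in SYS YSY YS Ysym fixX.
have [psdH HH] := psd_sqrtP psdS; set H := psd_sqrt S in psdH HH.
rewrite (@psd_sqrt_unique _ (X^T *m X) (X^T *m Y *m X)).
- by rewrite -mulmxA mxtrace_mulC -mulmxA -SS mulmxA -YS SYS.
- have -> : X^T *m Y *m X = (X^T *m Y *m H) *m (X^T *m Y *m H)^T.
    rewrite !trmx_mul trmxK Ysym psdH.1 !mulmxA -(mulmxA _ H H) HH.
    by rewrite -{1}YSY !mulmxA.
  exact: psd_gram.
- have -> : X^T *m Y *m X *m (X^T *m Y *m X) =
      X^T *m (Y *m (X *m X^T) *m Y *m X).
    by rewrite !mulmxA.
  by rewrite -SS (mulmxA Y S S) -YS SYS fixX.
Qed.

(** * Ranges, null spaces and orthonormal bases *)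

Lemma mxrange_sub_factor m n p (X : 'M[R]_(m, n)) (Y : 'M[R]_(m, p)) :
  mxrange X `<=` mxrange Y -> exists Z, X = Y *m Z.
Proof.
move=> h; have /submxP[D hD] : (X^T <= Y^T)%MS.
  apply/row_subP => i; rewrite -tr_col colE.
  have [|u ->] := h (X *m delta_mx i 0); first by exists (delta_mx i 0).
  by rewrite trmx_mul submxMl.
by exists D^T; apply: trmx_inj; rewrite trmx_mul trmxK.
Qed.

Lemma mxrange_sub_null m n p (N : 'M[R]_(m, n)) (Z : 'M[R]_(p, m)) :
  mxrange N `<=` mxnull Z <-> Z *m N = 0.
Proof.
split=> [h|ZN0 _ [u ->]]; last by rewrite /mxnull /= mulmxA ZN0 mul0mx.
apply/matrixP => i j.
have : mxnull Z (N *m delta_mx j 0) by apply: h; exists (delta_mx j 0).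
by move=> /colP/(_ i); rewrite mulmxA -colE !mxE.
Qed.

Lemma range_null_bases n r m (A : 'M[R]_n) (U : 'M[R]_(n, r))
    (V : 'M[R]_(n, m)) :
  A^T = A -> onbasis U (mxrange A) -> onbasis V (mxnull A) ->
  [/\ U^T *m V = 0, U *m U^T + V *m V^T = 1%:M,
      A = U *m blk U U A *m U^T & blk U U A \in unitmx].
Proof.
move=> Asym [UU rU] [VV rV].
have [X UAX] : exists X, U = A *m X by apply: mxrange_sub_factor; rewrite rU.
have [Y AUY] : exists Y, A = U *m Y by apply: mxrange_sub_factor; rewrite rU.
have AV : A *m V = 0 by apply/mxrange_sub_null; rewrite rV.
have UV : U^T *m V = 0 by rewrite UAX trmx_mul Asym -mulmxA AV mulmx0.
have UUA : U *m U^T *m A = A by rewrite AUY mulmxA -(mulmxA U) UU mulmx1.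
have AUU : A *m (U *m U^T) = A.
  by apply: trmx_inj; rewrite !trmx_mul trmxK Asym UUA.
have AE : A = U *m blk U U A *m U^T.
  by rewrite /blk !mulmxA UUA -mulmxA AUU.
split=> //.
(* A kills 1 - U U^T, so its columns lie in the span of V; applying V V^T then identifies it with V
   V^T. *)
- have [Z hZ] : exists Z, 1%:M - U *m U^T = V *m Z.
    apply: mxrange_sub_factor; rewrite rV; apply/mxrange_sub_null.
    by rewrite mulmxBr mulmx1 AUU subrr.
  have VU : V^T *m U = 0 by rewrite -[LHS]trmxK trmx_mul trmxK UV trmx0.
  have hW : V *m V^T *m (1%:M - U *m U^T) = V *m V^T.
    by rewrite mulmxBr mulmx1 !mulmxA -(mulmxA V) VU mulmx0 mul0mx subr0.
  by rewrite -hW hZ !mulmxA -(mulmxA V V^T V) VV mulmx1 -hZ addrC subrK.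
- suff /mulmx1_unit[] : blk U U A *m (U^T *m X) = 1%:M by [].
  by rewrite /blk -!mulmxA (mulmxA U) (mulmxA A) AUU -UAX UU.
Qed.

End RealMatrices.

(** * Block calculus in the bases U, V *)

Section Blocks.
Variables (R : realType) (n r m : nat) (U : 'M[R]_(n, r)) (V : 'M[R]_(n, m)).

Lemma of_blocksE a b c d :
  of_blocks U V a b c d =
  U *m a *m U^T + V *m c *m U^T + (U *m b *m V^T + V *m d *m V^T).
Proof. by rewrite /of_blocks tr_row_mx mul_row_block mul_row_col !mulmxDl. Qed.

Lemma tr_of_blocks a b c d :
  (of_blocks U V a b c d)^T = of_blocks U V a^T c^T b^T d^T.
Proof. by rewrite /of_blocks !trmx_mul trmxK tr_block_mx mulmxA. Qed.

Hypotheses (UU : U^T *m U = 1%:M) (VV : V^T *m V = 1%:M) (UV : U^T *m V = 0).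
Hypothesis UUVV : U *m U^T + V *m V^T = 1%:M.

Let VU : V^T *m U = 0.
Proof. by apply: trmx_inj; rewrite trmx_mul trmxK trmx0. Qed.

Lemma of_blocks_blk X :
  X = of_blocks U V (blk U U X) (blk U V X) (blk V U X) (blk V V X).
Proof.
rewrite of_blocksE /blk !mulmxA -!mulmxDl UUVV mul1mx.
by rewrite -!mulmxA -mulmxDr UUVV mulmx1.
Qed.

Lemma blk_of_blocks a b c d (X := of_blocks U V a b c d) :
  [/\ blk U U X = a, blk U V X = b, blk V U X = c & blk V V X = d].
Proof.
by split; rewrite /X of_blocksE /blk !mulmxDr !mulmxDl !mulmxA ?UU ?VV ?UV ?VU
  !mul0mx !mul1mx -!mulmxA ?UU ?VV ?UV ?VU !mulmx0 !mulmx1 ?addr0 ?add0r.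
Qed.

Lemma mul_of_blocks a b c d a' b' c' d' :
  of_blocks U V a b c d *m of_blocks U V a' b' c' d' =
  of_blocks U V (a *m a' + b *m c') (a *m b' + b *m d')
                (c *m a' + d *m c') (c *m b' + d *m d').
Proof.
rewrite /of_blocks -mulmx_block -!mulmxA; congr (_ *m (_ *m _)).
rewrite !mulmxA; congr (_ *m _); rewrite -[RHS]mul1mx; congr (_ *m _).
by rewrite tr_row_mx mul_col_row UU VV UV VU -scalar_mx_block.
Qed.

Lemma psd_of_blocks a b :
  psd (of_blocks U V a b 0 0) <-> psd a /\ b = 0.
Proof.
split=> [[sym pos]|[[sym pos] ->]].
  have [Xa Xb _ _] := blk_of_blocks a b 0 0.
  have [Ya Yb _ _] := blk_of_blocks a^T 0 b^T 0.
  rewrite tr_of_blocks !trmx0 in sym.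
  split; last by rewrite -Xb -sym Yb.
  split=> [|v]; first by rewrite -Ya sym Xa.
  have -> : v^T *m a *m v = (U *m v)^T *m of_blocks U V a b 0 0 *m (U *m v).
    by rewrite -{1}Xa /blk trmx_mul !mulmxA.
  exact: pos.
rewrite of_blocksE !(mulmx0, mul0mx) !addr0; split=> [|v].
  by rewrite !trmx_mul trmxK sym mulmxA.
by have := pos (U^T *m v); rewrite trmx_mul trmxK !mulmxA.
Qed.

End Blocks.

(** * Block lower triangular factors of B *)

Section LowerTriangularFactor.
Variables (R : realType) (r m k : nat) (L1 : 'M[R]_(r, k)) (L2 : 'M[R]_(m, k)).
Variables (G : 'M[R]_r) (Gu : G \in unitmx).
Let B11 := L1 *m L1^T.
Let B21 := L2 *m L1^T.
Let C := G^T *m B11 *m G.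
Let S := psd_sqrt C.
Let a := invmx G^T *m S.

Let psdC : psd C.
Proof.
have -> : C = (G^T *m L1) *m (G^T *m L1)^T.
  by rewrite /C /B11 trmx_mul trmxK !mulmxA.
exact: psd_gram.
Qed.

Let Ssym : S^T = S. Proof. by have [[]] := psd_sqrtP psdC. Qed.
Let SS : S *m S = C. Proof. by have [] := psd_sqrtP psdC. Qed.

Let GTu : G^T \in unitmx. Proof. by rewrite unitmx_tr Gu. Qed.

Let SYSY : S *m mp_inv S = mp_inv S *m S.
Proof. by have [] := sym_mp_invP Ssym. Qed.

(** B11^(1/2) G and S have the same Gram matrix C, hence the same null space. *)
Lemma sqrt_kernel p (N : 'M[R]_(r, p)) :
  psd_sqrt B11 *m G *m N = 0 <-> S *m N = 0.
Proof.
have [[sym _] sq] : psd (psd_sqrt B11) /\ psd_sqrt B11 *m psd_sqrt B11 = B11.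
  exact: psd_sqrtP (psd_gram L1).
set Q := psd_sqrt B11 in sym sq *.
have e : (Q *m G *m N)^T *m (Q *m G *m N) = (S *m N)^T *m (S *m N).
  rewrite !trmx_mul sym Ssym !mulmxA -(mulmxA _ Q Q) sq.
  by rewrite -(mulmxA _ S S) SS /C !mulmxA.
by split=> h; apply: tr_mulmx_eq0; rewrite ?e ?h -?e ?h mulmx0.
Qed.

Lemma factor_block11 : a *m a^T = B11.
Proof.
rewrite /a trmx_mul Ssym trmx_inv trmxK !mulmxA -(mulmxA _ S S) SS.
by rewrite /C !mulmxA mulVmx // mul1mx mulmxK.
Qed.

Lemma factor_block21 (N : 'M[R]_(r, m)) : S *m N = 0 ->
  (B21 *m G *m mp_inv S + N^T) *m a^T = B21.
Proof.
move=> SN; rewrite /a trmx_mul Ssym trmx_inv trmxK mulmxA mulmxDl.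
have -> : N^T *m S = 0 by apply: trmx_inj; rewrite trmx_mul trmxK Ssym SN trmx0.
rewrite addr0; have fixS : S *m mp_inv S *m (G^T *m L1) = G^T *m L1.
  by apply: sqrt_mp_fix; rewrite // SS /C /B11 trmx_mul trmxK !mulmxA.
have [_ _ _ Ysym] := sym_mp_invP Ssym.
have -> : B21 *m G *m mp_inv S *m S = B21 *m G.
  rewrite /B21 -!mulmxA; congr (_ *m _); apply: trmx_inj.
  by rewrite !trmx_mul trmxK Ssym Ysym -mulmxA fixS.
by rewrite mulmxK.
Qed.

(** S^+ N = 0 removes the cross terms; what remains is [gram_projection] between L2 and L2^T. *)
Lemma factor_block22 (N : 'M[R]_(r, m)) (c := B21 *m G *m mp_inv S + N^T) :
  S *m N = 0 -> c *m c^T = B21 *m mp_inv B11 *m B21^T + N^T *m N.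
Proof.
move=> SN; have [_ YSY _ Ysym] := sym_mp_invP Ssym.
have YN : mp_inv S *m N = 0.
  by rewrite -YSY -(mulmxA _ S) SYSY -!mulmxA SN !mulmx0.
have NY : N^T *m mp_inv S = 0.
  by apply: trmx_inj; rewrite trmx_mul trmxK Ysym YN trmx0.
rewrite /c [(_ + _)^T]linearD /= trmxK mulmxDl !mulmxDr !trmx_mul Ysym.
rewrite -(mulmxA _ _ N) YN mulmx0 addr0 !(mulmxA N^T) NY !mul0mx add0r.
congr (_ + _); have := gram_projection Gu Ssym SS.
rewrite /B21 !trmxK => /(congr1 (fun X => L2 *m X *m L2^T)).
by rewrite !mulmxA.
Qed.

Lemma factor_block21_solution (c : 'M[R]_(m, r)) : c *m a^T = B21 ->
  exists2 N : 'M[R]_(r, m), S *m N = 0 & c = B21 *m G *m mp_inv S + N^T.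
Proof.
have [SYS _ _ Ysym] := sym_mp_invP Ssym.
rewrite /a trmx_mul Ssym trmx_inv trmxK => <-.
(* The hypothesis reads B21 G = c S, so B21 G S^+ = c S S^+ and N^T must be the remainder. *)
exists ((c - c *m (S *m mp_inv S))^T).
  rewrite linearB /= !trmx_mul Ysym Ssym mulmxBr !mulmxA SYS.
  by rewrite subrr.
by rewrite trmxK !mulmxA mulmxKV // addrC subrK.
Qed.

End LowerTriangularFactor.

(** For L the root of B and any K with K K^T = A, [tr_psd_sqrt_gram] moves the trace to the root of
    L A L, which no longer involves K; take K = A^(1/2) and K = F. *)
Lemma tr_psd_sqrt_gram_conj (R : realType) n p (A B : 'M[R]_n)
    (F : 'M[R]_(n, p)) :
  psd A -> psd B -> A = F *m F^T ->
  \tr (psd_sqrt (psd_sqrt A *m B *m psd_sqrt A)) =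
  \tr (psd_sqrt (F^T *m B *m F)).
Proof.
move=> psdA psdB AF; have [[Hsym _] HH] := psd_sqrtP psdA.
have [[Lsym _]] := psd_sqrtP psdB; set L := psd_sqrt B in Lsym * => <-.
have gramE q (K : 'M[R]_(n, q)) :
    K^T *m (L *m L) *m K = (K^T *m L) *m (K^T *m L)^T.
  by rewrite trmx_mul trmxK Lsym !mulmxA.
have outer q (K : 'M[R]_(n, q)) :
    (K^T *m L)^T *m (K^T *m L) = L^T *m (K *m K^T) *m L.
  by rewrite trmx_mul trmxK !mulmxA.
by rewrite -{1}Hsym !gramE !tr_psd_sqrt_gram !outer -AF Hsym HH.
Qed.

(** * Solution set and Monge criterion *)

Theorem theorem4p7 (R : realType) (n r m : nat) (A B : 'M[R]_n)
    (U : 'M[R]_(n, r)) (V : 'M[R]_(n, m)) (G11 : 'M[R]_r)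
    (hA : psd A) (hB : psd B) (hrank : (\rank B <= \rank A)%N)
    (hU : onbasis U (mxrange A)) (hV : onbasis V (mxnull A))
    (hG11 : greens (blk U U A) G11) :
  let G := of_blocks U V G11 0 0 0 in
  let B11 := blk U U B in
  let B21 := blk V U B in
  let BA := schur_compl U V B in
  let C := G11^T *m B11 *m G11 in
  let admissible (N12 : 'M[R]_(r, m)) (M22 : 'M[R]_m) :=
    [/\ mxrange N12 `<=` mxnull (psd_sqrt B11 *m G11),
        psd_le (N12^T *m N12) BA
      & M22 *m M22^T = BA - N12^T *m N12] in
  let sol (N12 : 'M[R]_(r, m)) (M22 : 'M[R]_m) :=
    of_blocks U V
      (invmx G11^T *m psd_sqrt C)                      0
      (B21 *m G11 *m mp_inv (psd_sqrt C) + N12^T)      M22 in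
  [set M : 'M[R]_n | greens B M /\ psd (G^T *m M)] =
    [set M : 'M[R]_n | exists N12 M22, admissible N12 M22 /\ M = sol N12 M22]
  /\
  forall (N12 : 'M[R]_(r, m)) (M22 : 'M[R]_m), admissible N12 M22 ->
    ((exists T : 'M[R]_n, ot_matrix A B T /\ sol N12 M22 = T *m G) <-> M22 = 0)
    /\ (M22 = 0 <-> N12^T *m N12 = BA).
Proof.
move=> G B11 B21 BA C admissible sol.
have [Asym _] := hA; have [UU _] := hU; have [VV _] := hV.
have [UV UUVV AE A11u] := range_null_bases Asym hU hV.
have GG : G11 *m G11^T = blk U U A := hG11.
have Gu : G11 \in unitmx.
  have /mulmx1_unit[//] : G11 *m (G11^T *m invmx (blk U U A)) = 1%:M.
  by rewrite mulmxA GG mulmxV.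
have GTu : G11^T \in unitmx by rewrite unitmx_tr.
have [[Lsym _] LL] := psd_sqrtP hB; set L := psd_sqrt B in Lsym LL.
have {}LL : B = L *m L^T by rewrite Lsym.
pose L1 := U^T *m L; pose L2 := V^T *m L.
have e11 : B11 = L1 *m L1^T by rewrite /B11 /blk LL /L1 trmx_mul trmxK !mulmxA.
have e21 : B21 = L2 *m L1^T by rewrite /B21 /blk LL /L1 trmx_mul trmxK !mulmxA.
clearbody L1 L2.
have e12 : blk U V B = B21^T by rewrite /B21 /blk !trmx_mul trmxK hB.1 !mulmxA.
have psdC : psd C.
  have -> : C = (G11^T *m L1) *m (G11^T *m L1)^T.
    by rewrite /C e11 trmx_mul trmxK !mulmxA.
  exact: psd_gram.
have [psdS _] := psd_sqrtP psdC.
have kernel := @sqrt_kernel _ _ _ L1 G11; rewrite -e11 -/C in kernel.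
have f11 := @factor_block11 _ _ _ L1 _ Gu; rewrite -e11 -/C in f11.
have f21 := @factor_block21 _ _ _ _ L1 L2 _ Gu; rewrite -e11 -e21 -/C in f21.
have f22 := @factor_block22 _ _ _ _ L1 L2 _ Gu; rewrite -e11 -e21 -/C in f22.
have sol21 := @factor_block21_solution _ _ _ _ L1 L2 _ Gu.
rewrite -e11 -e21 -/C in sol21.
set S := psd_sqrt C in psdS kernel f11 f21 f22 sol21 sol *.
have BAE : BA = blk V V B - B21 *m mp_inv B11 *m B21^T.
  by rewrite /BA /schur_compl e12.
have admissible_kernel N12 M22 : admissible N12 M22 -> S *m N12 = 0.
  by case=> /mxrange_sub_null/kernel.
have sol_gram N12 M22 :
    admissible N12 M22 -> sol N12 M22 *m (sol N12 M22)^T = B.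
  move=> adm; have SN := admissible_kernel _ _ adm; have [_ _ M22E] := adm.
  rewrite /sol tr_of_blocks trmx0 mul_of_blocks // !(mulmx0, mul0mx) !addr0.
  (* The upper right block is the transpose of the lower left one, so [f21] serves for both. *)
  rewrite f11 f21 // f22 // M22E BAE -[X in of_blocks _ _ _ X]trmxK.
  rewrite trmx_mul trmxK f21 //.
  rewrite -[blk V V B - _ - _]addrA -opprD [X in of_blocks _ _ _ _ _ X]addrC.
  by rewrite subrK [B in RHS](of_blocks_blk UUVV) e12.
have G_mul X : G^T *m X =
    of_blocks U V (G11^T *m blk U U X) (G11^T *m blk U V X) 0 0.
  rewrite {1}[X](of_blocks_blk UUVV) /G tr_of_blocks !trmx0 mul_of_blocks //.
  by rewrite !mul0mx !addr0.
split.
  apply/seteqP; split=> [M [/= MM psdM]|M /= [N12 [M22 [adm ->]]]].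
    have := psdM; rewrite G_mul => /(psd_of_blocks UU VV UV)[psdM11 GM12].
    have M12 : blk U V M = 0 by rewrite -(mulKmx GTu (blk U V M)) GM12 mulmx0.
    have ME := of_blocks_blk UUVV M; rewrite M12 in ME.
    set M11 := blk U U M in ME psdM11; set M21 := blk V U M in ME.
    set M22 := blk V V M in ME.
    have BE : B = of_blocks U V (M11 *m M11^T) (M11 *m M21^T) (M21 *m M11^T)
                    (M21 *m M21^T + M22 *m M22^T).
      rewrite -MM {1 2}ME tr_of_blocks trmx0 mul_of_blocks //.
      by rewrite !(mulmx0, mul0mx) !addr0.
    have [b11 _ b21 b22] := blk_of_blocks UU VV UV (M11 *m M11^T) (M11 *m M21^T)
      (M21 *m M11^T) (M21 *m M21^T + M22 *m M22^T).
    rewrite -BE in b11 b21 b22.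
    have SE : S = G11^T *m M11.
      apply: psd_sqrt_unique => //.
      by rewrite -{2}psdM11.1 trmx_mul trmxK /C /B11 b11 !mulmxA.
    have M11E : M11 = invmx G11^T *m S by rewrite SE mulKmx.
    have [|N12 SN M21E] := sol21 M21; first by rewrite -M11E -b21.
    have M22E : M22 *m M22^T = BA - N12^T *m N12.
      rewrite BAE b22 [M21]M21E f22 // -[RHS]addrA -opprD.
      by rewrite [X in X - _]addrC addrK.
    exists N12, M22; split; last by rewrite ME M11E {1}M21E.
    split=> //; first exact/mxrange_sub_null/kernel.
    by rewrite /psd_le -M22E; apply: psd_gram.
  split; first exact: sol_gram.
  rewrite G_mul; have [-> -> _ _] := blk_of_blocks UU VV UV (invmx G11^T *m S) 0
    (B21 *m G11 *m mp_inv S + N12^T) M22.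
  by apply/(psd_of_blocks UU VV UV); rewrite mulKVmx // mulmx0.
move=> N12 M22 adm; have [_ _ M22E] := adm; split; last first.
  split=> [M0|NN]; last by apply: mulmx_tr_eq0; rewrite M22E NN subrr.
  by apply/esym/eqP; rewrite -subr_eq0 -M22E M0 mul0mx.
have [s11 _ _ s22] := blk_of_blocks UU VV UV (invmx G11^T *m S) 0
    (B21 *m G11 *m mp_inv S + N12^T) M22.
have GE : G = U *m G11 *m U^T by rewrite /G of_blocksE !(mulmx0, mul0mx) !addr0.
split=> [[T [_ solT]]|M0].
  (* G V = 0, so T G has zero lower right block. *)
  by rewrite -s22 -/(sol N12 M22) solT GE /blk -!mulmxA UV !mulmx0.
have AG : A = (U *m G11) *m (U *m G11)^T by rewrite {1}AE trmx_mul -GG !mulmxA.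
have [W solW] : exists W, sol N12 M22 = W *m U^T.
  exists (U *m (invmx G11^T *m S) +
          V *m (B21 *m G11 *m mp_inv S + N12^T)).
  by rewrite /sol M0 of_blocksE !(mulmx0, mul0mx) !addr0 -mulmxDl.
(* This T satisfies T F = W for F = U G11, so T A T^T = W W^T = M M^T = B, and tr(A T) = tr(F^T W) =
   tr S. *)
exists (W *m invmx G11 *m U^T); split; last first.
  by rewrite solW GE !mulmxA -(mulmxA _ U^T U) UU mulmx1 mulmxKV.
have TF : W *m invmx G11 *m U^T *m (U *m G11) = W.
  by rewrite mulmxA -(mulmxA _ U^T U) UU mulmx1 mulmxKV.
split.
  rewrite {1}AG mulmxA TF -mulmxA -trmx_mul TF -(sol_gram _ _ adm) solW.
  by rewrite trmx_mul trmxK mulmxA -(mulmxA _ U^T U) UU mulmx1.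
rewrite (tr_psd_sqrt_gram_conj hA hB AG) {1}AG -mulmxA mxtrace_mulC.
rewrite -[X in \tr X = _]mulmxA TF.
have -> : (U *m G11)^T *m B *m (U *m G11) = C.
  by rewrite /C /B11 /blk trmx_mul !mulmxA.
rewrite trmx_mul -mulmxA; congr (\tr _).
have -> : U^T *m W = invmx G11^T *m S.
  by rewrite -s11 -/(sol _ _) solW /blk -!mulmxA UU mulmx1.
by rewrite mulKVmx.
Qed.
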